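(* Let $N\ge 2$ be a natural number and let $F_N$ be the $N\times N$ unitary Fourier matrix, $[F_N]_{i,j}=\frac{1}{\sqrt N}e^{\mathbf i\frac{2\pi}{N}(i-1)(j-1)}$, $i,j\in\{1,\dots,N\}$. Then the defect $\mathbf d(F_N)$ is equal to zero if and only if $N$ is prime.
   Context: Let $f$ be the map sending a complex $N\times N$ matrix $U$ to the real matrix $(|U_{i,j}|^2)_{i,j}$, regarded as a smooth map between real vector spaces, with differential at $U$ given by $Df_U(V)=\big(2\,\mathrm{Re}(\overline{U_{i,j}}V_{i,j})\big)_{i,j}$. For an $N\times N$ unitary matrix $U$ let $T_U=\{EU: E\in\mathbb C^{N\times N},\ E^*=-E\}$ be the (real) tangent space at $U$ to the manifold of unitary matrices. The defect of $U$ is the integer $\mathbf d(U)=(N-1)^2-\dim_{\mathbb R}Df_U(T_U)$. *)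

(* Defs.v *)
From HB Require Import structures.
From mathcomp Require Import all_boot all_order all_algebra spectral.
From mathcomp Require Import complex.
From mathcomp Require Import reals trigo ring.

Set Implicit Arguments.
Unset Strict Implicit.
Unset Printing Implicit Defensive.

Import Order.TTheory GRing.Theory Num.Theory.

Local Open Scope ring_scope.
Local Open Scope sesquilinear_scope.
Local Open Scope complex_scope.

(* 'M[R[i]]_N is canonically a vector space over R[i].  realified R N is an
   alias of the same type, carrying its structure of vector space over R, of
   dimension 2 N^2; \dim below is the real dimension because of this alias. *)
Definition realified (R : rcfType) (N : nat) : Type := 'M[R[i]]_N.

Section Realified.
Variables (R : rcfType) (N : nat).

HB.instance Definition _ := GRing.Zmodule.on (realified R N).

Definition realified_scale (a : R) (A : realified R N) : realified R N :=
  a%:C *: (A : 'M[R[i]]_N).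

Fact realified_scaleA (a b : R) (A : realified R N) :
  realified_scale a (realified_scale b A) = realified_scale (a * b) A.
Proof. by rewrite /realified_scale scalerA rmorphM. Qed.

Fact realified_scale1 : left_id 1 realified_scale.
Proof. by move=> A; rewrite /realified_scale rmorph1 scale1r. Qed.

Fact realified_scaleDr : right_distributive realified_scale +%R.
Proof. by move=> a A B; rewrite /realified_scale scalerDr. Qed.

Fact realified_scaleDl (A : realified R N) :
  {morph realified_scale^~ A : a b / a + b}.
Proof. by move=> a b; rewrite /realified_scale rmorphD /= scalerDl. Qed.

HB.instance Definition _ := GRing.Zmodule_isLmodule.Build R (realified R N)
  realified_scaleA realified_scale1 realified_scaleDr realified_scaleDl.

Lemma realified_scaleE (a : R) (A : realified R N) (i j : 'I_N) :
  (a *: A : 'M[R[i]]_N) i j = a%:C * A i j.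
Proof. by rewrite mxE. Qed.

Fact realified_vect_axiom : Vector.axiom (N * N + N * N) (realified R N).
Proof.
pose f (A : realified R N) : 'rV[R]_(N * N + N * N) :=
  row_mx (mxvec (map_mx (@complex.Re R) A)) (mxvec (map_mx (@complex.Im R) A)).
pose g (v : 'rV[R]_(N * N + N * N)) : realified R N :=
  \matrix_(i, j) (vec_mx (lsubmx v) i j +i* vec_mx (rsubmx v) i j).
exists f.
  move=> a A B; rewrite /f scale_row_mx add_row_mx -!linearP /=.
  congr row_mx; congr mxvec; apply/matrixP=> i j; rewrite !mxE;
    by case: (A i j) (B i j) => [x y] [z t] /=; rewrite mul0r ?subr0 ?addr0.
exists g => [A|v]; rewrite /f /g.
  rewrite row_mxKl row_mxKr !mxvecK; apply/matrixP=> i j; rewrite !mxE.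
  by case: (A i j).
rewrite -[RHS]hsubmxK; congr row_mx; rewrite -[RHS]vec_mxK; congr mxvec;
  by apply/matrixP=> i j; rewrite !mxE.
Qed.

HB.instance Definition _ :=
  Lmodule_hasFinDim.Build R (realified R N) realified_vect_axiom.

Definition sqabs (U : realified R N) : 'M[R]_N :=
  \matrix_(i, j) ComplexField.Normc.normc (U i j) ^+ 2.

Definition Dsqabs (U V : realified R N) : 'M[R]_N :=
  \matrix_(i, j) (2 * complex.Re ((U i j)^* * V i j)).

Fact Dsqabs_is_linear (U : realified R N) : linear (Dsqabs U).
Proof.
move=> a A B; apply/matrixP=> i j; rewrite !mxE.
case: (U i j) (A i j) (B i j) => [u v] [x y] [z t] /=.
rewrite !mul0r subr0 addr0 mulrCA -mulrDr; congr (_ * _).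
by rewrite !mulNr !opprK !mulrDr !(mulrCA a) addrACA.
Qed.

HB.instance Definition _ (U : realified R N) :=
  GRing.isLinear.Build R (realified R N) 'M[R]_N _ (Dsqabs U)
    (Dsqabs_is_linear U).

(* Dsqabs U is the differential of sqabs at U: the remainder is quadratic. *)
Lemma sqabsD (U V : realified R N) :
  sqabs (U + V) = sqabs U + Dsqabs U V + sqabs V.
Proof.
apply/matrixP=> i j; rewrite !mxE.
case: (U i j) (V i j) => [u v] [x y] /=.
rewrite !sqr_sqrtr ?addr_ge0 ?sqr_ge0 //; ring.
Qed.

Definition add_adj (E : realified R N) : realified R N :=
  (E : 'M[R[i]]_N)^t* + E.

Fact add_adj_is_linear : linear add_adj.
Proof.
move=> a A B; apply/matrixP=> i j; rewrite !mxE rmorphD rmorphM /=.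
have -> : Num.conj a%:C = a%:C :> R[i].
  by apply: conj_Creal; apply/complex_realP; exists a.
by rewrite mulrDr addrACA.
Qed.

HB.instance Definition _ :=
  GRing.isLinear.Build R (realified R N) (realified R N) _ add_adj
    add_adj_is_linear.

Definition skewherm : {vspace realified R N} := lker (linfun add_adj).

Lemma mem_skewherm (E : realified R N) :
  reflect ((E : 'M[R[i]]_N)^t* = - (E : 'M[R[i]]_N)) (E \in skewherm).
Proof. by rewrite memv_ker lfunE /= addr_eq0; exact: eqP. Qed.

Definition mulr_by (U E : realified R N) : realified R N :=
  (E : 'M[R[i]]_N) *m (U : 'M[R[i]]_N).

Fact mulr_by_is_linear (U : realified R N) : linear (mulr_by U).
Proof. by move=> a A B; rewrite /mulr_by mulmxDl -scalemxAl. Qed.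

HB.instance Definition _ (U : realified R N) :=
  GRing.isLinear.Build R (realified R N) (realified R N) _ (mulr_by U)
    (mulr_by_is_linear U).

Definition tangent (U : realified R N) : {vspace realified R N} :=
  (linfun (mulr_by U) @: skewherm)%VS.

Lemma mem_tangent (U V : realified R N) :
  V \in tangent U <->
  exists2 E : 'M[R[i]]_N, E^t* = - E & V = E *m (U : 'M[R[i]]_N).
Proof.
split=> [/memv_imgP[E /mem_skewherm skE ->]|[E skE ->]].
  by exists E => //; rewrite lfunE.
apply/memv_imgP; exists (E : realified R N); first exact/mem_skewherm.
by rewrite lfunE.
Qed.

Definition defect (U : 'M[R[i]]_N) : int :=
  (N%:Z - 1) ^+ 2 - (\dim (linfun (Dsqabs U) @: tangent U))%:Z.

End Realified.

(* expi t is exp (it). *)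
Definition expi (R : realType) (t : R) : R[i] := cos t +i* sin t.

(* 'I_N is {0, ..., N-1}, so no shift of the indices is needed. *)
Definition fourier (R : realType) (N : nat) : 'M[R[i]]_N :=
  \matrix_(j, k) ((Num.sqrt N%:R)^-1%:C *
                  expi (2 * pi / N%:R * (j%:R * k%:R))).

(* Main.v *)
From HB Require Import structures.
Require Import Defs.
From mathcomp Require Import all_boot all_order all_algebra spectral complex.
From mathcomp Require Import reals trigo zify ring lra.

Set Implicit Arguments.
Unset Strict Implicit.
Unset Printing Implicit Defensive.

Import Order.TTheory GRing.Theory Num.Theory.
Local Open Scope ring_scope.
Local Open Scope sesquilinear_scope.
Local Open Scope complex_scope.

(** Encode a skew-Hermitian matrix E by the real matrix M := Re E + Im E, of
    which Re E and Im E are the antisymmetric and symmetric parts.  With indices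
    in Z/N, entry (i, j) of the differential at F_N along E F_N is, up to the
    factor 1/N, the discrete Hartley transform (kernel cos + sin) at frequency j
    of the function d |-> M_(i,i-d) - M_(i+d,i).  This transform being
    injective, the kernel K consists of the M with M_(i,i-d) = M_(i+d,i) for all
    i and d, that is, the d-th cyclic diagonal is invariant under translation by
    d.  Since \dim Df(T) = N^2 - \dim K, the defect is \dim K - (2N - 1).  The
    matrices that are constant on every cyclic diagonal except the main one form
    a subspace of K of dimension 2N - 1; it is all of K exactly when every
    nonzero d generates Z/N, that is, when N is prime. *)

(** * Orthogonality and injectivity of the discrete Hartley transform *)

Section Hartley.
(* Only 'I_n.+2 carries the ring structure of Z/N. *)
Variables (R : realType) (n : nat).
Local Notation N := n.+2.
Implicit Types x y d e : 'I_N.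

Definition zcos x : R := cos (2 * pi / N%:R * x%:R).
Definition zsin x : R := sin (2 * pi / N%:R * x%:R).
Definition zcas x : R := zcos x + zsin x.

(** Reduction mod N changes the angle by full turns only, so the trigonometric formulas hold for the
    arithmetic of Z/N. *)
Lemma angle_mod (a : nat) :
  2 * pi / N%:R * a%:R = 2 * pi / N%:R * (a %% N)%:R + pi *+ 2 *+ (a %/ N) :> R.
Proof.
rewrite {1}(divn_eq a N) natrD natrM mulrDr addrC; congr (_ + _).
rewrite -(mulr_natr (pi *+ 2)) -(mulr_natl pi 2) [_%:R * N%:R]mulrC mulrA.
by rewrite divfK ?pnatr_eq0.
Qed.

Lemma cos_modN (a : nat) :
  cos (2 * pi / N%:R * (a %% N)%:R) = cos (2 * pi / N%:R * a%:R) :> R.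
Proof. by rewrite (angle_mod a) (periodicn (@cosD2pi R)). Qed.

Lemma sin_modN (a : nat) :
  sin (2 * pi / N%:R * (a %% N)%:R) = sin (2 * pi / N%:R * a%:R) :> R.
Proof. by rewrite (angle_mod a) (periodicn (@sinD2pi R)). Qed.

Lemma zcos0 : zcos 0 = 1. Proof. by rewrite /zcos mulr0 cos0. Qed.

Lemma zcosD x y : zcos (x + y) = zcos x * zcos y - zsin x * zsin y.
Proof. by rewrite /zcos cos_modN natrD mulrDr cosD. Qed.

Lemma zsinD x y : zsin (x + y) = zsin x * zcos y + zcos x * zsin y.
Proof. by rewrite /zsin sin_modN natrD mulrDr sinD. Qed.

Lemma angle_opp x :
  2 * pi / N%:R * (N - x)%:R = - (2 * pi / N%:R * x%:R) + pi *+ 2 :> R.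
Proof.
rewrite natrB ?(ltnW (ltn_ord x)) // mulrBr divfK ?pnatr_eq0 //.
by rewrite addrC mulr_natl.
Qed.

Lemma zcosN x : zcos (- x) = zcos x.
Proof. by rewrite /zcos cos_modN angle_opp cosD2pi cosN. Qed.

Lemma zsinN x : zsin (- x) = - zsin x.
Proof. by rewrite /zsin sin_modN angle_opp sinD2pi sinN. Qed.

Lemma zcos_eq1 x : zcos x = 1 -> x = 0.
Proof.
have [//|x0 /eqP] := eqVneq x 0.
(* The half angle lies strictly between 0 and [pi] when x is nonzero, so its sine cannot vanish. *)
have -> : zcos x = 1 - sin (pi / N%:R * x%:R) ^+ 2 *+ 2.
  rewrite /zcos (_ : _ * x%:R = (pi / N%:R * x%:R) *+ 2).
    by rewrite cos_mulr2n cos2sin2; ring.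
  by rewrite -(mulr_natl (pi / _ * _)) !mulrA.
rewrite subr_eq addrC -subr_eq subrr eq_sym mulrn_eq0 /= sqrf_eq0 gt_eqF //.
have N0 : (0 : R) < N%:R by rewrite ltr0n.
apply: sin_gt0_pi; apply/andP; split.
  by rewrite mulr_gt0 ?divr_gt0 ?pi_gt0 // ltr0n lt0n.
by rewrite mulrAC ltr_pdivrMr // ltr_pM2l ?pi_gt0 // ltr_nat.
Qed.

Lemma sum_zsin d : \sum_j zsin (d * j) = 0.
Proof.
suff: (\sum_j zsin (d * j)) *+ 2 = 0 by move/eqP; rewrite mulrn_eq0 => /eqP.
rewrite mulr2n.
rewrite {1}(reindex_inj (@oppr_inj 'I_N)) -big_split big1 //= => j _.
by rewrite mulrN zsinN addNr.
Qed.

Lemma sum_zcos d : \sum_j zcos (d * j) = (d == 0)%:R * N%:R.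
Proof.
have [->|d0] := eqVneq d 0.
  under eq_bigr => j _ do rewrite mul0r zcos0.
  by rewrite sumr_const card_ord mul1r.
(* Shifting j by 1 multiplies the sum by [zcos d], which differs from 1; the sine terms sum to 0. *)
rewrite mul0r; have : \sum_j zcos (d * j) = zcos d * \sum_j zcos (d * j).
  rewrite {1}(reindex_inj (addrI (1 : 'I_N))).
  under eq_bigr => j _ do rewrite mulrDr mulr1 zcosD.
  by rewrite sumrB -!mulr_sumr sum_zsin mulr0 subr0.
move/eqP; rewrite -subr_eq0 -{1}[X in X - _]mul1r -mulrBl mulf_eq0 subr_eq0.
by case/orP=> /eqP // /esym/zcos_eq1/eqP; rewrite (negPf d0).
Qed.

(** By the identity cas a cas b = cos (a - b) + sin (a + b). *)
Lemma zcas_ortho d e :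
  \sum_j zcas (d * j) * zcas (e * j) = (d == e)%:R * N%:R.
Proof.
transitivity (\sum_j (zcos ((d - e) * j) + zsin ((d + e) * j))).
  apply: eq_bigr => j _; rewrite (mulrBl j d e) (mulrDl d e j).
  by rewrite zcosD zcosN zsinN zsinD /zcas; ring.
by rewrite big_split /= sum_zcos sum_zsin addr0 subr_eq0.
Qed.

Lemma zcas_sum_inj (a : 'I_N -> R) :
  (forall j, \sum_d a d * zcas (d * j) = 0) -> forall d, a d = 0.
Proof.
move=> a0 e; apply: (mulIf (_ : N%:R != 0 :> R)); first by rewrite pnatr_eq0.
rewrite mul0r; transitivity (\sum_d a d * ((d == e)%:R * N%:R)).
  rewrite (bigD1 e) //= eqxx mul1r big1 ?addr0 // => d /negPf ->.
  by rewrite mul0r mulr0.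
under eq_bigr => d _ do rewrite -zcas_ortho mulr_sumr.
rewrite exchange_big big1 // => j _.
rewrite -[RHS](mul0r (zcas (e * j))) -[in RHS](a0 j) mulr_suml.
by apply: eq_bigr => d _; rewrite mulrA.
Qed.

Lemma fourierE i j :
  fourier R N i j =
  (Num.sqrt N%:R)^-1%:C * (zcos (i * j) +i* zsin (i * j)).
Proof. by rewrite mxE /expi /zcos /zsin cos_modN sin_modN natrM. Qed.

End Hartley.

Lemma Re_sum (R : rcfType) (I : finType) (f : I -> R[i]) :
  complex.Re (\sum_k f k) = \sum_k complex.Re (f k).
Proof. by apply: (big_morph (@complex.Re R)) => // -[a b] [c d]. Qed.

(** * Real coordinates on skew-Hermitian matrices *)

Section SkewHermitian.
Variables (R : realType) (N : nat).
Implicit Types M : 'M[R]_N.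

(** The inverse of the encoding E |-> Re E + Im E. *)
Definition skew_of M : realified R N :=
  \matrix_(i, j) ((M i j - M j i) / 2 +i* ((M i j + M j i) / 2)).

Fact skew_of_is_linear : linear skew_of.
Proof.
move=> a A B; apply/matrixP=> i j; rewrite !mxE.
by apply/eqP; rewrite eq_complex /=; apply/andP; split; apply/eqP; field.
Qed.

HB.instance Definition _ :=
  GRing.isLinear.Build R 'M[R]_N (realified R N) _ skew_of skew_of_is_linear.

Lemma limg_skew_of : limg (linfun skew_of) = skewherm R N.
Proof.
apply/vspaceP=> E; apply/idP/mem_skewherm => [/memv_imgP[M _ ->]|skE].
  rewrite lfunE; apply/matrixP=> i j; rewrite !mxE.
  by apply/eqP; rewrite eq_complex /=; apply/andP; split; apply/eqP; field.
apply/memv_imgP.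
exists (\matrix_(i, j) (complex.Re (E i j) + complex.Im (E i j))).
  exact: memvf.
rewrite lfunE; apply/matrixP=> i j; rewrite !mxE.
have := congr1 (fun A : 'M_N => A i j) skE; rewrite !mxE.
case: (E i j) (E j i) => [a b] [c d] /= [ac bd].
by apply/eqP; rewrite eq_complex /=; apply/andP; split; apply/eqP; lra.
Qed.

End SkewHermitian.

(** * The kernel of the differential and its dimension *)

Section FourierKernel.
Variables (R : realType) (n : nat).
Local Notation N := n.+2.
Local Notation F := (fourier R N).
Implicit Types M : 'M[R]_N.

Lemma Dsqabs_fourier_skew M i j :
  Dsqabs F (mulr_by F (skew_of M)) i j =
  N%:R^-1 * \sum_d (M i (i - d) - M (i + d) i) * zcas R (d * j).
Proof.
transitivity (N%:R^-1 * \sum_k (M i k * zcas R ((i - k) * j)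
                                - M k i * zcas R ((k - i) * j))).
  rewrite [LHS]mxE [mulr_by _ _ _ _]mxE mulr_sumr Re_sum !mulr_sumr.
  apply: eq_bigr => k _; rewrite !fourierE [skew_of M i k]mxE.
  have -> : N%:R^-1 = (Num.sqrt N%:R)^-1 ^+ 2 :> R.
    by rewrite exprVn sqr_sqrtr ?ler0n.
  rewrite /zcas !mulrBl !zcosD !zsinD !zcosN !zsinN /=; field.
  by rewrite sqrtr_eq0 -ltNge ltr0n.
congr (_ * _).
under [RHS]eq_bigr => d _ do rewrite mulrBl.
rewrite !sumrB; congr (_ - _).
  (* Put k = i - d in the first sum and k = i + d in the second. *)
  rewrite [LHS](reindex_inj (subrI i)); apply: eq_bigr => d _.
  by rewrite subKr.
rewrite [LHS](reindex_inj (addrI i)); apply: eq_bigr => d _.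
by rewrite addrAC subrr add0r.
Qed.

Definition fourier_hom : 'Hom('M[R]_N, 'M[R]_N) :=
  (linfun (Dsqabs F) \o (linfun (mulr_by F) \o linfun (@skew_of R N)))%VF.

Lemma fourier_homE M : fourier_hom M = Dsqabs F (mulr_by F (skew_of M)).
Proof. by rewrite !comp_lfunE !lfunE. Qed.

Lemma mem_ker_fourier_hom M :
  reflect (forall i d, M i (i - d) = M (i + d) i) (M \in lker fourier_hom).
Proof.
rewrite memv_ker; apply: (iffP eqP) => [/matrixP M0 i d|per].
  apply/eqP; rewrite -subr_eq0; apply/eqP; move: d; apply: zcas_sum_inj => j.
  have := M0 i j; rewrite fourier_homE Dsqabs_fourier_skew mxE.
  by move/eqP; rewrite mulf_eq0 invr_eq0 pnatr_eq0 => /eqP.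
apply/matrixP=> i j; rewrite fourier_homE Dsqabs_fourier_skew.
by rewrite big1 ?mulr0 ?mxE // => d _; rewrite per subrr mul0r.
Qed.

(** Rank-nullity for [fourier_hom], whose image is that of the tangent space because [skew_of] is
    onto; [N + n.+1] is 2N - 1. *)
Lemma defect_fourierE :
  defect F = (\dim (lker fourier_hom))%:Z - (N + n.+1)%N%:Z.
Proof.
have -> : (\dim (lker fourier_hom))%:Z =
    (N * N)%N%:Z - (\dim (linfun (Dsqabs F) @: tangent F))%:Z.
  have <- : (\dim (lker fourier_hom) + \dim (limg fourier_hom) = N * N)%N.
    by rewrite -{1}(capfv (lker _)) limg_ker_dim dimvf dim_matrix.
  by rewrite !limg_comp limg_skew_of PoszD addrK.
by rewrite /defect; lia.
Qed.

(** The first N coordinates fill the main diagonal freely; each of the other N - 1 is the value on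
    one cyclic diagonal, [unlift ord0] being [None] exactly at offset 0. *)
Definition diag_const (v : 'rV[R]_(N + n.+1)) : 'M[R]_N :=
  \matrix_(i, j) if unlift ord0 (i - j) is Some k then v 0 (rshift N k)
                 else v 0 (lshift n.+1 i).

Fact diag_const_is_linear : linear diag_const.
Proof.
move=> a u v; apply/matrixP=> i j; rewrite !mxE.
by case: unlift => [k|]; rewrite ?mxE.
Qed.

HB.instance Definition _ :=
  GRing.isLinear.Build R 'rV[R]_(N + n.+1) 'M[R]_N _ diag_const
    diag_const_is_linear.

Lemma diag_const_diag v i : diag_const v i i = v 0 (lshift n.+1 i).
Proof. by rewrite mxE subrr unlift_none. Qed.

Lemma diag_const_offdiag v i j k :
  i - j = lift ord0 k -> diag_const v i j = v 0 (rshift N k).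
Proof. by move=> ij; rewrite mxE ij liftK. Qed.

Lemma diag_const_inj : injective diag_const.
Proof.
move=> u v /matrixP uv; apply/rowP=> x; case: (split_ordP x) => [i|k] ->.
  by rewrite -!diag_const_diag uv.
by rewrite -!(@diag_const_offdiag _ (lift ord0 k) 0) ?subr0.
Qed.

Lemma dim_diag_const : \dim (limg (linfun diag_const)) = (N + n.+1)%N.
Proof.
rewrite limg_dim_eq ?dimvf ?dim_matrix; first exact: mul1n.
suff /eqP -> : lker (linfun diag_const) == 0%VS by rewrite capv0.
by apply/lker0P=> u v; rewrite !lfunE; apply: diag_const_inj.
Qed.

Lemma diag_const_sub_ker : (limg (linfun diag_const) <= lker fourier_hom)%VS.
Proof.
apply/subvP=> _ /memv_imgP[v _ ->]; rewrite lfunE.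
apply/mem_ker_fourier_hom=> i d.
have [k dk|->] := unliftP ord0 d; last by rewrite subr0 addr0.
by rewrite !(@diag_const_offdiag _ _ _ k) // ?subKr // addrAC subrr add0r.
Qed.

Lemma ker_sub_diag_const :
  prime N -> (lker fourier_hom <= limg (linfun diag_const))%VS.
Proof.
move=> prN; apply/subvP=> M /mem_ker_fourier_hom per.
apply/memv_imgP; exists (row_mx (\row_i M i i) (\row_k M (lift ord0 k) 0)).
  exact: memvf.
rewrite lfunE; apply/matrixP=> i j.
have [k dk|ij] := unliftP ord0 (i - j); last first.
  by move/subr0_eq: ij => ->; rewrite diag_const_diag row_mxEl mxE.
rewrite (diag_const_offdiag _ dk) row_mxEr mxE -dk.
have -> : M i j = M (j + (i - j)) j by rewrite addrC subrK.
move: (i - j) dk => {i} d dk.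
(* Each step moves by -d along the d-th diagonal. As d is invertible mod N, j / d steps reach column
   0, where the witness was read off. *)
have perm m : M (j + d) j = M (j - d *+ m + d) (j - d *+ m).
  elim: m => [|m ->]; first by rewrite subr0.
  by rewrite -per mulrSr opprD !addrA subrK.
have Ud : d \is a GRing.unit.
  rewrite -[d]natr_Zp (@unitZpE N) // prime_coprime // gtnNdvd ?ltn_ord //.
  by rewrite dk.
by rewrite (perm (j / d)) -[d *+ _]mulr_natr natr_Zp mulrC divrK // subrr add0r.
Qed.

Lemma composite_ker_not_sub :
  ~~ prime N -> ~~ (lker fourier_hom <= limg (linfun diag_const))%VS.
Proof.
case/primePn=> // -[d /andP[d_gt1 d_ltN] dvN]; apply/negP=> /subvP sub.
(* For a proper divisor d of N, the indicator of the multiples of d on the d-th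
   diagonal is d-periodic but not constant. *)
pose M : 'M[R]_N := \matrix_(i, j) ((i - j == inord d) && (d %| i)%N)%:R.
have vd : (inord d : 'I_N) = d :> nat by rewrite inordK.
have /sub/memv_imgP[v _ Mv] : M \in lker fourier_hom.
  apply/mem_ker_fourier_hom=> i e; rewrite !mxE subKr addrAC subrr add0r.
  (* Since d divides N, reduction mod N preserves divisibility by d. *)
  by case: eqP => //= ->; rewrite /dvdn modn_dvdm // vd modnDr.
have [k dk] : exists k, inord d = lift ord0 k :> 'I_N.
  case: (unliftP ord0 (inord d : 'I_N)) => [k ->|d0]; first by exists k.
  by move: vd d_gt1; rewrite d0 /= => <-.
(* Two entries of the d-th diagonal: the first is 1, the second 0 because d > 1 does not divide d +
   1. *)
have : M (inord d) 0 = M (inord d + 1) 1.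
  rewrite Mv lfunE !(@diag_const_offdiag _ _ _ k) //= ?subr0 //.
  by rewrite addrK.
rewrite !mxE subr0 addrK eqxx vd dvdnn /= /dvdn modn_dvdm // vd.
by rewrite modnDl modn_small // => /eqP; rewrite oner_eq0.
Qed.

End FourierKernel.

Theorem mainTheorem3 (R : realType) (N : nat) (hN : (2 <= N)%N) :
  defect (fourier R N) = 0 <-> prime N.
Proof.
case: N hN => [|[|n]] // _; rewrite defect_fourierE -(dim_diag_const R).
have sub := @diag_const_sub_ker R n.
split=> [/eqP|prN]; last first.
  suff -> : lker (fourier_hom R n) = limg (linfun (@diag_const R n)).
    by rewrite subrr.
  by apply/eqP; rewrite eqEsubv ker_sub_diag_const.
rewrite subr_eq0 eqz_nat => dimE; apply: contraTT isT => npr.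
(* Inclusion and equal dimensions force equality. *)
have : limg (linfun (@diag_const R n)) == lker (fourier_hom R n).
  by rewrite eqEdim sub (eqP dimE) leqnn.
by rewrite eqEsubv (negPf (composite_ker_not_sub R npr)) andbF.
Qed.
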